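(* Let $H_m = 1 + \frac{1}{2} + \cdots + \frac{1}{m}$ denote the $m$-th harmonic number, with $H_0 = 0$. Then $$ \sum_{i=0}^{\infty} \left( -\frac{1}{64} \right)^{i} \binom{2i}{i}^{3} (4i+1) H_{2i} = -\frac{2 \ln 2}{\pi}. $$ *)

(* Defs.v *)
From Stdlib Require Import Reals Lra Lia.
From Coquelicot Require Import Coquelicot.
Open Scope R_scope.

(* [sum_n_m a 1 0] is the empty sum, so [harmonic 0 = 0]; see [harmonic_0]. *)
Definition harmonic (m : nat) : R := sum_n_m (fun k : nat => / INR k) 1 m.

Lemma harmonic_0 : harmonic 0 = 0.
Proof. apply (sum_n_m_zero (G := R_AbelianMonoid)); lia. Qed.

Lemma harmonic_S (m : nat) : harmonic (S m) = harmonic m + / INR (S m).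
Proof. apply (sum_n_Sm (G := R_AbelianMonoid)); lia. Qed.

(* Main.v *)
(** Put [W k = C(2k,k) / 4^k] and
    [S(y) = sum_k (4k+1) (W k)^2 prod_{j<k} (y-j) / (y+3/2+j)].
    At [y = -1/2] the product is [(-1)^k W k] and its derivative in [y] is
    [-2 H_{2k}] times that, so the series of the theorem is [- S'(-1/2) / 2].
    A WZ certificate gives [S(y+1) = rho(y) S(y)] with
    [rho(y) = (y+3/2) / (y+1)]; differentiating it,
    [S'/S (-1/2) = S'/S (m-1/2) - sum_{j<m} rho'/rho (j-1/2)], where the last sum
    tends to [-2 ln 2] while [S'/S (m-1/2)] tends to [0] by a crude estimate.
    Comparing [S(m-1/2)] with the terminating sums [S(m-1)] and [S(m)], which are
    products, gives [S(-1/2) = 2/PI] by Wallis' formula.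
    All this is done with partial sums up to [N], so that no convergence has to
    be known beforehand: the certificate terms vanish as [N] grows with [m] fixed,
    and the estimates at [m-1/2] are uniform in [N > m]. *)

Require Import Defs.
From Stdlib Require Import Reals Lra Lia.
From Coquelicot Require Import Coquelicot.
Open Scope R_scope.

(** * The summand, its derivative and the WZ certificate *)

Fixpoint wallis (k : nat) : R :=
  match k with
  | O => 1
  | S k => wallis k * ((INR k + 1 / 2) / (INR k + 1))
  end.

(** In rising factorials this is [(-1)^k (-y)_k / (y+3/2)_k]. Hence [qsum] truncates a very
    well-poised [4F3] at [-1] with parameters [a = b = 1/2], [c = -y], whose sum is
    [Gamma(y+3/2) / (Gamma(3/2) Gamma(y+1))]. *)
Fixpoint quot (y : R) (k : nat) : R :=
  match k with
  | O => 1
  | S k => quot y k * ((y - INR k) / (y + 3 / 2 + INR k))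
  end.

(* The derivative of [quot y k] with respect to [y]. *)
Fixpoint dquot (y : R) (k : nat) : R :=
  match k with
  | O => 0
  | S k =>
      dquot y k * ((y - INR k) / (y + 3 / 2 + INR k))
      + quot y k * ((2 * INR k + 3 / 2) / (y + 3 / 2 + INR k) ^ 2)
  end.

Definition weight (k : nat) : R := (4 * INR k + 1) * wallis k ^ 2.

Definition rho (y : R) : R := (y + 3 / 2) / (y + 1).
Definition drho (y : R) : R := - (1 / 2) / (y + 1) ^ 2.

(* The WZ certificate: [rho y * (cert y N * quot y N)] is the defect of the
   recurrence for the partial sums, see [qsum_shift]. *)
Definition cert (y : R) (N : nat) : R :=
  -2 * (INR N + 1 / 2) ^ 2 * wallis N ^ 2 / (y + 3 / 2 + INR N).

Definition qsum (y : R) (N : nat) : R := sum_n (fun k => weight k * quot y k) N.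
Definition dqsum (y : R) (N : nat) : R := sum_n (fun k => weight k * dquot y k) N.

Lemma Rmult_le_1 (a b : R) : 0 <= a -> 0 <= b -> a <= 1 -> b <= 1 -> a * b <= 1.
Proof. nra. Qed.

(** * Recurrences in the index and in [y] *)

Lemma qsum_S (y : R) (N : nat) :
  qsum y (S N) = qsum y N + weight (S N) * quot y (S N).
Proof. unfold qsum. rewrite sum_Sn. reflexivity. Qed.

Lemma dqsum_S (y : R) (N : nat) :
  dqsum y (S N) = dqsum y N + weight (S N) * dquot y (S N).
Proof. unfold dqsum. rewrite sum_Sn. reflexivity. Qed.

Lemma quot_S (y : R) (k : nat) :
  quot y (S k) = quot y k * ((y - INR k) / (y + 3 / 2 + INR k)).
Proof. reflexivity. Qed.

Lemma dquot_S (y : R) (k : nat) :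
  dquot y (S k) =
  dquot y k * ((y - INR k) / (y + 3 / 2 + INR k))
  + quot y k * ((2 * INR k + 3 / 2) / (y + 3 / 2 + INR k) ^ 2).
Proof. reflexivity. Qed.

(** Shifting [k] along with [y] keeps the numerators [y - j] and adds only [y + 1]. Without the
    index shift one would divide by [y + 1 - k], which can vanish at integers. *)
Lemma quot_shift (y : R) (k : nat) : - (1 / 2) <= y ->
  quot (y + 1) (S k) =
  quot y k * ((y + 1) * (y + 3 / 2)
              / ((y + 3 / 2 + INR k) * (y + 5 / 2 + INR k))).
Proof.
  intros hy; induction k as [|k IH].
  - simpl. field. lra.
  - pose proof (pos_INR k). rewrite S_INR.
    rewrite (quot_S (y + 1) (S k)).
    rewrite IH, S_INR. simpl. field. lra.
Qed.

(** The product rule applied to [quot_shift]: the four reciprocals form the logarithmic derivative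
    of its rational factor. *)
Lemma dquot_shift (y : R) (k : nat) : - (1 / 2) <= y ->
  dquot (y + 1) (S k) =
  (dquot y k + quot y k * (/ (y + 1) + / (y + 3 / 2) - / (y + 3 / 2 + INR k)
                             - / (y + 5 / 2 + INR k)))
  * ((y + 1) * (y + 3 / 2) / ((y + 3 / 2 + INR k) * (y + 5 / 2 + INR k))).
Proof.
  intros hy; induction k as [|k IH].
  - simpl. field. lra.
  - pose proof (pos_INR k). rewrite S_INR.
    rewrite (dquot_S (y + 1) (S k)).
    rewrite IH, quot_shift, S_INR by assumption. simpl. field. lra.
Qed.

Lemma qsum_shift (y : R) (N : nat) : - (1 / 2) <= y ->
  qsum (y + 1) N = rho y * (qsum y N + cert y N * quot y N).
Proof.
  intros hy; induction N as [|N IH].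
  - unfold qsum. rewrite !sum_O. unfold rho, cert, weight. simpl. field. lra.
  - pose proof (pos_INR N).
    rewrite !qsum_S, IH, quot_shift by assumption.
    unfold rho, cert, weight. rewrite S_INR. simpl. field. lra.
Qed.

(** This is [qsum_shift] differentiated in [y]. The certificate depends on [y] only through its
    denominator, so its derivative is [- cert y N / (y + 3/2 + N)]. *)
Lemma dqsum_shift (y : R) (N : nat) : - (1 / 2) <= y ->
  dqsum (y + 1) N =
  rho y * (dqsum y N + cert y N * (dquot y N - quot y N / (y + 3 / 2 + INR N)))
  + drho y * (qsum y N + cert y N * quot y N).
Proof.
  intros hy; induction N as [|N IH].
  - unfold qsum, dqsum. rewrite !sum_O. unfold rho, drho, cert, weight.
    simpl. field. lra.
  - pose proof (pos_INR N).
    rewrite !qsum_S, !dqsum_S, IH, dquot_shift by assumption.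
    unfold rho, drho, cert, weight. rewrite S_INR. simpl. field. lra.
Qed.

(** * Elementary bounds, and the terminating sums *)

Lemma wallis_pos (k : nat) : 0 < wallis k.
Proof.
  induction k as [|k IH]; simpl; [lra|]. pose proof (pos_INR k).
  apply Rmult_lt_0_compat; [exact IH|]. apply Rdiv_lt_0_compat; lra.
Qed.

(** The left side decreases from 1, because [(k + 1/2)(k + 3/2) <= (k + 1)^2]. *)
Lemma wallis_sqr_le (k : nat) : (2 * INR k + 1) * wallis k ^ 2 <= 1.
Proof.
  induction k as [|k IH]; [simpl; lra|].
  pose proof (pos_INR k) as hk. pose proof (wallis_pos k).
  change (wallis (S k)) with (wallis k * ((INR k + 1 / 2) / (INR k + 1))).
  rewrite S_INR.
  replace ((2 * (INR k + 1) + 1) * (wallis k * ((INR k + 1 / 2) / (INR k + 1))) ^ 2)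
    with ((2 * INR k + 1) * wallis k ^ 2
          * (((INR k + 3 / 2) * (INR k + 1 / 2)) / (INR k + 1) ^ 2)) by (field; lra).
  apply Rmult_le_1.
  - apply Rmult_le_pos; [lra|]. apply pow2_ge_0.
  - apply Rdiv_le_0_compat; nra.
  - exact IH.
  - apply -> Rdiv_le_1; nra.
Qed.

Lemma weight_bounds (k : nat) : 0 <= weight k <= 2.
Proof.
  unfold weight. pose proof (wallis_sqr_le k). pose proof (pos_INR k).
  pose proof (pow2_ge_0 (wallis k)). split; nra.
Qed.

Lemma cert_bound (y : R) (N : nat) : - (1 / 2) <= y -> Rabs (cert y N) <= 1.
Proof.
  intros hy. pose proof (wallis_sqr_le N). pose proof (pos_INR N).
  pose proof (pow2_ge_0 (wallis N)).
  unfold cert, Rdiv. rewrite Rabs_mult, (Rabs_pos_eq (/ _))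
    by (left; apply Rinv_0_lt_compat; lra).
  apply -> Rdiv_le_1; [|lra].
  rewrite Rabs_left1 by nra. nra.
Qed.

Lemma quot_abs_le_1 (y : R) (k : nat) : - (1 / 2) <= y -> Rabs (quot y k) <= 1.
Proof.
  intros hy; induction k as [|k IH].
  - simpl. rewrite Rabs_R1. lra.
  - pose proof (pos_INR k). simpl. rewrite Rabs_mult.
    apply Rmult_le_1; try apply Rabs_pos; [exact IH|].
    apply Rabs_le. split.
    + apply Rle_div_r; lra.
    + apply -> Rdiv_le_1; lra.
Qed.

Lemma quot_mono (y z : R) (k : nat) :
  0 <= y -> INR k - 1 <= y -> y <= z -> 0 <= quot y k <= quot z k.
Proof.
  intros h0 hk hz; induction k as [|k IH]; [simpl; lra|].
  rewrite S_INR in hk. pose proof (pos_INR k).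
  destruct IH as [h1 h2]; [lra|]. simpl.
  assert (0 <= (y - INR k) / (y + 3 / 2 + INR k)) by (apply Rdiv_le_0_compat; lra).
  split; [now apply Rmult_le_pos|].
  apply Rmult_le_compat; try assumption.
  apply Rle_div_l; [lra|].
  replace ((z - INR k) / (z + 3 / 2 + INR k) * (y + 3 / 2 + INR k))
    with ((z - INR k) * (y + 3 / 2 + INR k) / (z + 3 / 2 + INR k)) by (field; lra).
  apply Rle_div_r; [lra|]. nra.
Qed.

(** At [y = m] the product of index [m + 1] is zero, which kills the certificate term; the
    recurrence then multiplies the sum by exactly [rho m]. *)
Lemma qsum_INR (m : nat) : qsum (INR m) m = (2 * INR m + 1) * wallis m.
Proof.
  induction m as [|m IH].
  - unfold qsum. rewrite sum_O. unfold weight. simpl. lra.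
  - pose proof (pos_INR m) as hm.
    assert (h0 : quot (INR m) (S m) = 0).
    { simpl. replace (INR m - INR m) with 0 by ring. unfold Rdiv. ring. }
    rewrite S_INR, qsum_shift, h0, qsum_S, h0, IH by lra.
    unfold rho. simpl. field. lra.
Qed.

(** * Heads and tails of the sums at [m - 1/2] *)

Lemma sum_n_Rle (f g : nat -> R) (N : nat) :
  (forall k, (k <= N)%nat -> f k <= g k) -> sum_n f N <= sum_n g N.
Proof. intros h. rewrite !sum_n_Reals. now apply sum_Rle. Qed.

Lemma sum_n_split (f : nat -> R) (m n : nat) :
  sum_n f (m + S n) = sum_n f m + sum_n (fun s => f (m + S s)%nat) n.
Proof.
  induction n as [|n IH].
  - rewrite Nat.add_1_r, sum_Sn, sum_O, Nat.add_1_r. reflexivity.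
  - rewrite (Nat.add_succ_r m (S n)), !sum_Sn, IH, (Nat.add_succ_r m (S n)).
    unfold plus; simpl. ring.
Qed.

(** Equal to the sum of [1 / (j + 1/2)] over [j < m], that is, twice the sum of the reciprocals of
    the first [m] odd numbers. *)
Definition odd_harmonic (m : nat) : R := 2 * harmonic (2 * m) - harmonic m.

Lemma odd_harmonic_S (m : nat) :
  odd_harmonic (S m) = odd_harmonic m + / (INR m + 1 / 2).
Proof.
  pose proof (pos_INR m). unfold odd_harmonic.
  replace (2 * S m)%nat with (S (S (2 * m))) by lia.
  rewrite !harmonic_S, !S_INR, mult_INR. simpl. field. lra.
Qed.

Lemma harmonic_nonneg (m : nat) : 0 <= harmonic m.
Proof.
  induction m as [|m IH]; [rewrite harmonic_0; lra|].
  rewrite harmonic_S. assert (0 < / INR (S m)); [|lra].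
  apply Rinv_0_lt_compat, lt_0_INR; lia.
Qed.

Lemma odd_harmonic_nonneg (m : nat) : 0 <= odd_harmonic m.
Proof.
  induction m as [|m IH].
  - unfold odd_harmonic. simpl. rewrite harmonic_0. lra.
  - rewrite odd_harmonic_S. pose proof (pos_INR m).
    assert (0 < / (INR m + 1 / 2)) by (apply Rinv_0_lt_compat; lra). lra.
Qed.

(** The factors with [j < k <= m] are positive, with logarithmic derivatives
    [(2j + 3/2) / ((m - 1/2 - j)(m + 1 + j))]. Bounding the numerators by [2k + 3/2] and [m + 1 + j]
    below by [m + 1] leaves the sum of [1 / (m - 1/2 - j)], a difference of two odd harmonic
    sums. *)
Lemma dquot_head (k n m : nat) : m = (k + n)%nat ->
  0 <= quot (INR m - 1 / 2) k /\
  0 <= dquot (INR m - 1 / 2) k <=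
    quot (INR m - 1 / 2) k
    * ((2 * INR k + 3 / 2) / (INR m + 1) * (odd_harmonic m - odd_harmonic n)).
Proof.
  revert n; induction k as [|k IH]; intros n hm.
  - simpl in *. subst n. split; [lra|]. split; [lra|].
    right. unfold Rdiv; ring.
  - destruct (IH (S n)) as [h1 [h2 h3]]; [lia|].
    pose proof (pos_INR k) as hk. pose proof (pos_INR n) as hn.
    assert (em : INR m = INR k + INR n + 1) by (rewrite hm, plus_INR, S_INR; ring).
    rewrite odd_harmonic_S in h3.
    rewrite (quot_S (INR m - 1 / 2) k).
    rewrite (dquot_S (INR m - 1 / 2) k).
    set (a := quot (INR m - 1 / 2) k) in *.
    set (d := dquot (INR m - 1 / 2) k) in *.
    set (q := (INR m - 1 / 2 - INR k) / (INR m - 1 / 2 + 3 / 2 + INR k)).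
    assert (hq : 0 <= q) by (apply Rdiv_le_0_compat; lra).
    assert (e : (2 * INR k + 3 / 2) / (INR m - 1 / 2 + 3 / 2 + INR k) ^ 2
                = q * ((2 * INR k + 3 / 2) / (INR m + 1 + INR k) * / (INR n + 1 / 2))).
    { unfold q. rewrite em. field. lra. }
    rewrite e, S_INR.
    assert (hv : 0 < / (INR n + 1 / 2)) by (apply Rinv_0_lt_compat; lra).
    assert (hc : 0 <= (2 * INR k + 3 / 2) / (INR m + 1 + INR k)
                   <= (2 * INR k + 3 / 2) / (INR m + 1)).
    { split; [apply Rdiv_le_0_compat; lra|]. unfold Rdiv.
      apply Rmult_le_compat_l; [lra|]. apply Rinv_le_contravar; lra. }
    assert (hc' : (2 * INR k + 3 / 2) / (INR m + 1)
                  <= (2 * (INR k + 1) + 3 / 2) / (INR m + 1)).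
    { unfold Rdiv. apply Rmult_le_compat_r; [|lra].
      left; apply Rinv_0_lt_compat; lra. }
    set (c := (2 * INR k + 3 / 2) / (INR m + 1 + INR k)) in *.
    set (c1 := (2 * INR k + 3 / 2) / (INR m + 1)) in *.
    set (c2 := (2 * (INR k + 1) + 3 / 2) / (INR m + 1)) in *.
    set (v := / (INR n + 1 / 2)) in *.
    assert (hh : 0 <= odd_harmonic m - (odd_harmonic n + v)).
    { unfold v. rewrite <- (odd_harmonic_S n). clear -hm. subst m.
      induction k as [|k IH].
      - simpl. lra.
      - replace (S (S k) + n)%nat with (S (S k + n)) by lia.
        rewrite (odd_harmonic_S (S k + n)). pose proof (pos_INR (S k + n)).
        assert (0 < / (INR (S k + n) + 1 / 2)) by (apply Rinv_0_lt_compat; lra).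
        lra. }
    set (t := odd_harmonic m - (odd_harmonic n + v)) in *.
    replace (odd_harmonic m - odd_harmonic n) with (t + v) by (unfold t; ring).
    assert (0 <= a * q) by now apply Rmult_le_pos.
    assert (0 <= c * v) by (apply Rmult_le_pos; lra).
    split; [assumption|]. split.
    + apply Rplus_le_le_0_compat; [now apply Rmult_le_pos|].
      rewrite <- Rmult_assoc. now apply Rmult_le_pos.
    + apply Rle_trans with (a * (c1 * t) * q + a * (q * (c * v))).
      * apply Rplus_le_compat_r. now apply Rmult_le_compat_r.
      * replace (a * (c1 * t) * q + a * (q * (c * v)))
          with (a * q * (c1 * t + c * v)) by ring.
        apply Rmult_le_compat_l; [assumption|]. nra.
Qed.

(** At a half-integer no factor vanishes, so the logarithmic derivative stays meaningful. It is at
    most [2 * odd_harmonic m] at index [m] by [dquot_head], and each later factor adds at most 4 in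
    absolute value. *)
Lemma dquot_tail (m s : nat) :
  Rabs (dquot (INR m - 1 / 2) (m + s)) <=
  Rabs (quot (INR m - 1 / 2) (m + s)) * (2 * odd_harmonic m + 4 * INR s).
Proof.
  pose proof (pos_INR m) as hm. pose proof (odd_harmonic_nonneg m) as hh.
  induction s as [|s IH].
  - destruct (dquot_head m 0 m) as [h1 [h2 h3]]; [lia|].
    rewrite Nat.add_0_r, !Rabs_pos_eq by assumption.
    apply Rle_trans with (1 := h3). apply Rmult_le_compat_l; [assumption|].
    replace (odd_harmonic 0) with 0
      by (unfold odd_harmonic; simpl; rewrite harmonic_0; ring).
    simpl. assert ((2 * INR m + 3 / 2) / (INR m + 1) <= 2) by (apply Rle_div_l; lra).
    nra.
  - pose proof (pos_INR s) as hs.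
    rewrite Nat.add_succ_r.
    rewrite (quot_S (INR m - 1 / 2) (m + s)).
    rewrite (dquot_S (INR m - 1 / 2) (m + s)).
    set (a := quot (INR m - 1 / 2) (m + s)) in *.
    set (d := dquot (INR m - 1 / 2) (m + s)) in *.
    rewrite plus_INR, S_INR.
    set (q := (INR m - 1 / 2 - (INR m + INR s))
              / (INR m - 1 / 2 + 3 / 2 + (INR m + INR s))).
    (* [- c] is the logarithmic derivative of the new factor [q]. *)
    set (c := (2 * (INR m + INR s) + 3 / 2)
              / ((2 * INR m + INR s + 1) * (INR s + 1 / 2))).
    assert (e : (2 * (INR m + INR s) + 3 / 2)
                / (INR m - 1 / 2 + 3 / 2 + (INR m + INR s)) ^ 2 = - q * c).
    { unfold q, c. field. lra. }
    assert (hc : 0 <= c <= 4).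
    { split; [apply Rdiv_le_0_compat; nra|]. apply Rle_div_l; nra. }
    rewrite e.
    replace (d * q + a * (- q * c)) with (q * (d - a * c)) by ring.
    rewrite (Rabs_mult q), (Rabs_mult a q).
    replace (Rabs a * Rabs q * (2 * odd_harmonic m + 4 * (INR s + 1)))
      with (Rabs q * (Rabs a * (2 * odd_harmonic m + 4 * (INR s + 1)))) by ring.
    apply Rmult_le_compat_l; [apply Rabs_pos|].
    apply Rle_trans with (Rabs d + Rabs a * c).
    + rewrite <- (Rabs_pos_eq c) at 2 by lra.
      rewrite <- Rabs_mult, <- (Rabs_Ropp (a * c)). apply Rabs_triang.
    + pose proof (Rabs_pos a). nra.
Qed.

(* With [b k = |quot y k|], [y = m - 1/2], the potential [b k (k + m) (k - m + 1)]
   decreases by at least [m / 2 * b k (k - m + 1)] at each step beyond [m]. *)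
Lemma quot_tail (m n : nat) : (1 <= m)%nat ->
  sum_n (fun s => Rabs (quot (INR m - 1 / 2) (m + S s)) * (INR s + 2)) n <= 12.
Proof.
  intros hm. assert (1 <= INR m) by (apply (le_INR 1); exact hm).
  set (b := fun s => Rabs (quot (INR m - 1 / 2) (m + S s))).
  assert (hb : forall s, 0 <= b s) by (intros; apply Rabs_pos).
  assert (hb0 : b O <= 1) by (apply quot_abs_le_1; lra).
  assert (hS : forall s, b (S s) * (2 * INR m + 2 + INR s) = b s * (INR s + 3 / 2)).
  { intros s. pose proof (pos_INR s). unfold b.
    rewrite (Nat.add_succ_r m (S s)).
    rewrite (quot_S (INR m - 1 / 2) (m + S s)).
    rewrite plus_INR, S_INR, Rabs_mult.
    replace ((INR m - 1 / 2 - (INR m + (INR s + 1)))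
             / (INR m - 1 / 2 + 3 / 2 + (INR m + (INR s + 1))))
      with (- ((INR s + 3 / 2) / (2 * INR m + 2 + INR s))) by (field; lra).
    rewrite Rabs_Ropp, (Rabs_pos_eq (_ / _)) by (apply Rdiv_le_0_compat; lra).
    field. lra. }
  assert (hp : INR m / 2 * sum_n (fun s => b s * (INR s + 2)) n
               + b (S n) * (2 * INR m + 2 + INR n) * (INR n + 3)
               <= b O * (4 * INR m + 2)).
  { induction n as [|n IH].
    - rewrite sum_O, hS. simpl. pose proof (hb O). nra.
    - rewrite sum_Sn. rewrite (hS (S n)). unfold plus; simpl plus.
      pose proof (hb (S n)). pose proof (pos_INR n). rewrite S_INR.
      apply Rle_trans with (2 := IH).
      assert (0 <= b (S n) * (3 / 2 * (INR m - 1) * (INR n + 3) + 1 / 2))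
        by (apply Rmult_le_pos; nra).
      simpl. nra. }
  (* As [b 0 <= 1], the potential gives at most [(8m + 4) / m], hence 12 for [m >= 1]. *)
  change (sum_n (fun s => b s * (INR s + 2)) n <= 12).
  pose proof (hb (S n)). pose proof (pos_INR n).
  assert (0 <= b (S n) * (2 * INR m + 2 + INR n) * (INR n + 3)) by
    (repeat apply Rmult_le_pos; lra).
  nra.
Qed.

Lemma sum_n_abs_le (f g : nat -> R) (c : R) (N : nat) :
  (forall k, Rabs (f k) <= c * g k) -> Rabs (sum_n f N) <= c * sum_n g N.
Proof.
  intros h; induction N as [|N IH]; [rewrite !sum_O; apply h|].
  rewrite !sum_Sn. unfold plus; simpl.
  apply Rle_trans with (1 := Rabs_triang _ _). specialize (h (S N)). lra.
Qed.

Lemma wallis_S (m : nat) :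
  wallis (S m) = wallis m * ((INR m + 1 / 2) / (INR m + 1)).
Proof. reflexivity. Qed.

(** A bounded error is enough: [qsum_bounds] multiplies it by [wallis m], which tends to 0. *)
Lemma qsum_tail (m n : nat) : (1 <= m)%nat ->
  Rabs (qsum (INR m - 1 / 2) (m + S n) - qsum (INR m - 1 / 2) m) <= 24.
Proof.
  intros hm. unfold qsum. rewrite sum_n_split.
  rewrite Rplus_minus_l.
  apply Rle_trans with
    (2 * sum_n (fun s => Rabs (quot (INR m - 1 / 2) (m + S s)) * (INR s + 2)) n).
  - apply sum_n_abs_le. intros s. destruct (weight_bounds (m + S s)).
    rewrite Rabs_mult, (Rabs_pos_eq (weight _)) by assumption.
    pose proof (pos_INR s). pose proof (Rabs_pos (quot (INR m - 1 / 2) (m + S s))).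
    apply Rmult_le_compat; nra.
  - pose proof (quot_tail m n hm). lra.
Qed.

(* [qsum] at the half-integer [m - 1/2] is squeezed between its values at the
   integers [m - 1] and [m], where the sum terminates. *)
Lemma qsum_bounds (m n : nat) : (1 <= m)%nat ->
  2 * INR m * wallis m ^ 2 - 24 * wallis m
    <= wallis m * qsum (INR m - 1 / 2) (m + S n)
    <= (2 * INR m + 1) * wallis m ^ 2 + 24 * wallis m.
Proof.
  intros hm. pose proof (qsum_tail m n hm) as ht. apply Rabs_le_between in ht.
  assert (hu : qsum (INR m - 1 / 2) m <= (2 * INR m + 1) * wallis m).
  { rewrite <- qsum_INR. apply sum_n_Rle. intros k hk.
    apply le_INR in hk. apply (le_INR 1) in hm. simpl in hm.
    apply Rmult_le_compat_l; [apply weight_bounds|]. apply quot_mono; lra. }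
  assert (hl : 2 * INR m * wallis m <= qsum (INR m - 1 / 2) m).
  { destruct m as [|m]; [lia|]. pose proof (pos_INR m).
    apply Rle_trans with (qsum (INR m) (S m)).
    (* The term of index [S m] is zero, and [(2m + 1) wallis m = 2(m + 1) wallis (m + 1)]. *)
    - rewrite qsum_S, qsum_INR, wallis_S, S_INR. simpl.
      right. field. lra.
    - apply sum_n_Rle. intros k hk. apply le_INR in hk. rewrite S_INR in *.
      apply Rmult_le_compat_l; [apply weight_bounds|]. apply quot_mono; lra. }
  pose proof (wallis_pos m). split; nra.
Qed.

(** The factor [2k + 3/2] in [dquot_head] also appears in [quot y k - quot y (S k) = quot y k (2k +
    3/2) / (m + 1 + k)]. Since [m + 1 + k <= 2m + 1], the bounds telescope instead of growing with
    the number of terms. *)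
Lemma dqsum_head (m : nat) :
  0 <= dqsum (INR m - 1 / 2) m <= 16 * odd_harmonic m.
Proof.
  pose proof (pos_INR m) as hm. pose proof (odd_harmonic_nonneg m) as hh.
  assert (hodd : forall k, 0 <= odd_harmonic k) by apply odd_harmonic_nonneg.
  set (y := INR m - 1 / 2).
  assert (hq : forall k, (k <= m)%nat ->
    quot y k * (2 * INR k + 3 / 2) <= (2 * INR m + 1) * (quot y k - quot y (S k))).
  { intros k hk. destruct (dquot_head k (m - k) m) as [h _]; [lia|]. fold y in h.
    apply le_INR in hk. pose proof (pos_INR k).
    rewrite (quot_S y k).
    replace (quot y k - quot y k * ((y - INR k) / (y + 3 / 2 + INR k)))
      with (quot y k * (2 * INR k + 3 / 2) / (INR m + 1 + INR k))
      by (unfold y; field; lra).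
    assert (0 <= quot y k * (2 * INR k + 3 / 2)) by (apply Rmult_le_pos; lra).
    set (p := quot y k * (2 * INR k + 3 / 2)) in *.
    replace ((2 * INR m + 1) * (p / (INR m + 1 + INR k)))
      with (p * ((2 * INR m + 1) / (INR m + 1 + INR k))) by (field; lra).
    assert (1 <= (2 * INR m + 1) / (INR m + 1 + INR k)) by (apply Rle_div_r; lra).
    nra. }
  assert (hsum : forall k, (k <= m)%nat ->
    0 <= dqsum y k <= 4 * odd_harmonic m * ((2 * INR m + 1) / (INR m + 1)) / 2
                      * (1 - quot y (S k))).
  { intros k; induction k as [|k IH]; intros hk.
    - unfold dqsum. rewrite sum_O.
      specialize (hq O hk). revert hq. unfold weight. simpl. intros hq.
      split; [lra|]. rewrite Rmult_0_r.
      apply Rmult_le_pos; [|nra].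
      assert (0 <= (2 * INR m + 1) / (INR m + 1)) by (apply Rdiv_le_0_compat; lra).
      nra.
    - destruct IH as [h1 h2]; [lia|]. rewrite dqsum_S.
      destruct (weight_bounds (S k)) as [w1 w2].
      destruct (dquot_head (S k) (m - S k) m) as [a1 [d1 d2]]; [lia|].
      fold y in a1, d1, d2. specialize (hq (S k) hk).
      split; [apply Rplus_le_le_0_compat; [|apply Rmult_le_pos]; assumption|].
      assert (hd : weight (S k) * dquot y (S k)
        <= 2 * (odd_harmonic m / (INR m + 1)
                * ((2 * INR m + 1) * (quot y (S k) - quot y (S (S k)))))).
      { apply Rmult_le_compat; try assumption.
        apply Rle_trans with (1 := d2).
        apply Rle_trans with
          (odd_harmonic m / (INR m + 1) * (quot y (S k) * (2 * INR (S k) + 3 / 2))).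
        - replace (odd_harmonic m / (INR m + 1)
                   * (quot y (S k) * (2 * INR (S k) + 3 / 2)))
            with (quot y (S k) * ((2 * INR (S k) + 3 / 2) / (INR m + 1)
                                  * odd_harmonic m)) by (field; lra).
          apply Rmult_le_compat_l; [assumption|].
          apply Rmult_le_compat_l.
          + pose proof (pos_INR (S k)). apply Rdiv_le_0_compat; lra.
          + specialize (hodd (m - S k)%nat). lra.
        - apply Rmult_le_compat_l; [|assumption]. apply Rdiv_le_0_compat; lra. }
      apply Rle_trans with (1 := Rplus_le_compat _ _ _ _ h2 hd).
      right. field. lra. }
  destruct (hsum m (Nat.le_refl m)) as [h1 h2]. split; [assumption|].
  apply Rle_trans with (1 := h2).
  pose proof (quot_abs_le_1 y (S m)) as ha.
  assert (hy : - (1 / 2) <= y) by (unfold y; lra).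
  specialize (ha hy). apply Rabs_le_between in ha.
  assert (0 <= (2 * INR m + 1) / (INR m + 1) <= 2).
  { split; [apply Rdiv_le_0_compat | apply Rle_div_l]; lra. }
  set (r := (2 * INR m + 1) / (INR m + 1)) in *.
  assert (0 <= odd_harmonic m * r <= odd_harmonic m * 2) by (split; nra).
  nra.
Qed.

(** The bound grows only logarithmically in [m], so [wallis m] times it tends to 0. The tail
    contributes [(4 * odd_harmonic m + 8) * 12], by [dquot_tail] and [quot_tail]. *)
Lemma dqsum_bound (m n : nat) : (1 <= m)%nat ->
  Rabs (dqsum (INR m - 1 / 2) (m + S n)) <= 64 * odd_harmonic m + 96.
Proof.
  intros hm. pose proof (odd_harmonic_nonneg m) as hh.
  unfold dqsum. rewrite sum_n_split.
  apply Rle_trans with (1 := Rabs_triang _ _).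
  pose proof (dqsum_head m) as [h1 h2]. unfold dqsum in h1, h2.
  rewrite (Rabs_pos_eq _ h1).
  assert (ht : Rabs (sum_n (fun s => weight (m + S s)
                                     * dquot (INR m - 1 / 2) (m + S s)) n)
    <= (4 * odd_harmonic m + 8)
       * sum_n (fun s => Rabs (quot (INR m - 1 / 2) (m + S s)) * (INR s + 2)) n).
  { apply sum_n_abs_le. intros s. destruct (weight_bounds (m + S s)).
    rewrite Rabs_mult, (Rabs_pos_eq (weight _)) by assumption.
    pose proof (dquot_tail m (S s)) as hd. rewrite S_INR in hd.
    pose proof (pos_INR s). set (b := Rabs (quot _ _)) in *.
    assert (0 <= b) by apply Rabs_pos.
    apply Rle_trans with (2 * (b * (2 * odd_harmonic m + 4 * (INR s + 1)))).
    - apply Rmult_le_compat; try assumption. apply Rabs_pos.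
    - replace ((4 * odd_harmonic m + 8) * (b * (INR s + 2)))
        with (2 * (b * ((2 * odd_harmonic m + 4) * (INR s + 2)))) by ring.
      apply Rmult_le_compat_l; [lra|]. apply Rmult_le_compat_l; nra. }
  pose proof (quot_tail m n hm).
  apply Rle_trans with (16 * odd_harmonic m + (4 * odd_harmonic m + 8) * 12); [|lra].
  apply Rplus_le_compat; [assumption|]. apply Rle_trans with (1 := ht).
  apply Rmult_le_compat_l; lra.
Qed.

(** * Wallis' formula from integrals of powers of the sine *)

Lemma ex_RInt_sin_pow (k : nat) : ex_RInt (fun x => sin x ^ k) 0 (PI / 2).
Proof.
  apply (ex_RInt_continuous (V := R_CompleteNormedModule)).
  intros x _. apply (ex_derive_continuous (V := R_NormedModule)).
  auto_derive. exact I.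
Qed.

Lemma RInt_sin_pow_rec (n : nat) :
  (INR n + 2) * RInt (fun x => sin x ^ (n + 2)) 0 (PI / 2)
  = (INR n + 1) * RInt (fun x => sin x ^ n) 0 (PI / 2).
Proof.
  (* The integrand is the derivative of [cos x * sin x ^ (n + 1)], which vanishes at both
     endpoints. *)
  assert (h : is_RInt (fun x => (INR n + 1) * sin x ^ n - (INR n + 2) * sin x ^ (n + 2))
                0 (PI / 2) (minus (cos (PI / 2) * sin (PI / 2) ^ (n + 1))
                                  (cos 0 * sin 0 ^ (n + 1)))).
  { apply (is_RInt_derive (fun x => cos x * sin x ^ (n + 1))).
    - intros x _. auto_derive; [exact I|].
      pose proof (sin2_cos2 x) as hsc. unfold Rsqr in hsc.
      replace (n + 1)%nat with (S n) by lia. replace (n + 2)%nat with (S (S n)) by lia.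
      simpl pred. simpl pow. rewrite S_INR.
      replace (cos x * (1 * cos x * ((INR n + 1) * sin x ^ n)))
        with ((INR n + 1) * sin x ^ n * (cos x * cos x)) by ring.
      replace (cos x * cos x) with (1 - sin x * sin x) by lra.
      ring.
    - intros x _. apply (ex_derive_continuous (V := R_NormedModule)).
      auto_derive. exact I. }
  rewrite cos_PI2, sin_0, pow_i, Rmult_0_l, Rmult_0_r in h by lia.
  apply (is_RInt_unique (V := R_CompleteNormedModule)) in h. unfold minus, plus, opp in h. simpl in h.
  assert (e : RInt (fun x => (INR n + 1) * sin x ^ n - (INR n + 2) * sin x ^ (n + 2))
                0 (PI / 2)
              = (INR n + 1) * RInt (fun x => sin x ^ n) 0 (PI / 2)
                - (INR n + 2) * RInt (fun x => sin x ^ (n + 2)) 0 (PI / 2)).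
  { apply is_RInt_unique.
    apply (is_RInt_minus (V := R_NormedModule));
      apply (is_RInt_scal (V := R_NormedModule));
      apply (RInt_correct (V := R_CompleteNormedModule)); apply ex_RInt_sin_pow. }
  lra.
Qed.

Lemma RInt_sin_pow_antitone (n : nat) :
  RInt (fun x => sin x ^ S n) 0 (PI / 2) <= RInt (fun x => sin x ^ n) 0 (PI / 2).
Proof.
  pose proof PI_RGT_0. apply RInt_le; try apply ex_RInt_sin_pow; [lra|].
  intros x hx. pose proof (SIN_bound x).
  assert (0 <= sin x) by (apply sin_ge_0; lra).
  pose proof (pow_le (sin x) n). simpl. nra.
Qed.

Lemma RInt_sin_pow_even (m : nat) :
  RInt (fun x => sin x ^ (2 * m)) 0 (PI / 2) = PI / 2 * wallis m.
Proof.
  induction m as [|m IH].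
  - simpl. rewrite RInt_const. unfold scal; simpl; unfold mult; simpl. ring.
  - pose proof (RInt_sin_pow_rec (2 * m)) as h. pose proof (pos_INR m).
    rewrite IH, mult_INR in h. simpl INR in h.
    replace (2 * S m)%nat with (2 * m + 2)%nat by lia. rewrite wallis_S.
    apply Rmult_eq_reg_l with (2 * INR m + 2); [|lra].
    replace (2 * INR m + 2) with ((1 + 1) * INR m + 2) at 1 by ring.
    rewrite h. field. lra.
Qed.

Lemma RInt_sin_pow_odd (m : nat) :
  RInt (fun x => sin x ^ (2 * m + 1)) 0 (PI / 2) = / ((2 * INR m + 1) * wallis m).
Proof.
  induction m as [|m IH].
  - apply is_RInt_unique. simpl.
    replace (/ ((2 * 0 + 1) * 1)) with (minus (- cos (PI / 2)) (- cos 0)).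
    + apply (is_RInt_derive (fun x => - cos x)).
      * intros x _. auto_derive; [exact I|]. ring.
      * intros x _. apply (ex_derive_continuous (V := R_NormedModule)).
        auto_derive. exact I.
    + rewrite cos_PI2, cos_0. unfold minus, plus, opp; simpl. field.
  - pose proof (RInt_sin_pow_rec (2 * m + 1)) as h. pose proof (pos_INR m).
    pose proof (wallis_pos m).
    rewrite IH, plus_INR, mult_INR in h. simpl INR in h.
    replace (2 * S m + 1)%nat with (2 * m + 1 + 2)%nat by lia. rewrite wallis_S, S_INR.
    apply Rmult_eq_reg_l with (2 * INR m + 3); [|lra].
    replace (2 * INR m + 3) with ((1 + 1) * INR m + 1 + 2) at 1 by ring.
    rewrite h. field. lra.
Qed.

Lemma is_lim_seq_inv_INR : is_lim_seq (fun m => / (2 * INR m + 1)) 0.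
Proof.
  apply is_lim_seq_ext with (fun m => / INR (2 * m + 1)).
  { intros m. rewrite plus_INR, mult_INR. reflexivity. }
  apply (is_lim_seq_subseq (fun n => / INR n)).
  - apply eventually_subseq. intros n. lia.
  - apply (is_lim_seq_inv _ p_infty); [apply is_lim_seq_INR|discriminate].
Qed.

(** The integral of [sin x ^ (2m + 1)] lies between those of exponents [2m + 2] and [2m];
    multiplying by [(2m + 1) wallis m] turns this into the squeeze. *)
Lemma wallis_sqr_lim : is_lim_seq (fun m => (2 * INR m + 1) * wallis m ^ 2) (2 / PI).
Proof.
  pose proof PI_RGT_0 as hpi.
  apply is_lim_seq_le_le with
    (u := fun _ => 2 / PI) (w := fun m => 2 / PI + 2 / PI * / (2 * INR m + 1)).
  - intros m. pose proof (pos_INR m). pose proof (wallis_pos m).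
    pose proof (RInt_sin_pow_antitone (2 * m)) as h1.
    pose proof (RInt_sin_pow_antitone (2 * m + 1)) as h2.
    replace (S (2 * m)) with (2 * m + 1)%nat in h1 by lia.
    replace (S (2 * m + 1)) with (2 * S m)%nat in h2 by lia.
    rewrite RInt_sin_pow_odd, RInt_sin_pow_even in h1.
    rewrite RInt_sin_pow_odd, RInt_sin_pow_even, wallis_S in h2.
    set (x := INR m) in *. set (w := wallis m) in *.
    assert (hp : 0 < (2 * x + 1) * w) by (apply Rmult_lt_0_compat; lra).
    apply (Rmult_le_compat_r ((2 * x + 1) * w)) in h1; [|lra].
    apply (Rmult_le_compat_r ((2 * x + 1) * w)) in h2; [|lra].
    rewrite Rinv_l in h1, h2 by lra.
    split.
    + apply Rle_div_l; [lra|]. nra.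
    + replace (2 / PI + 2 / PI * / (2 * x + 1))
        with (2 * (2 * x + 2) / (2 * x + 1) / PI) by (field; lra).
      apply -> Rle_div_r; [|lra]. apply -> Rle_div_r; [|lra].
      replace (PI / 2 * (w * ((x + 1 / 2) / (x + 1))) * ((2 * x + 1) * w))
        with (PI * ((2 * x + 1) * w ^ 2) * (2 * x + 1) / (4 * (x + 1))) in h2
        by (field; lra).
      apply Rle_div_l in h2; [|lra]. nra.
  - apply is_lim_seq_const.
  - replace (Finite (2 / PI)) with (Finite (2 / PI + 2 / PI * 0)) by (f_equal; ring).
    apply is_lim_seq_plus'; [apply is_lim_seq_const|].
    apply is_lim_seq_scal_l with (lu := 0). apply is_lim_seq_inv_INR.
Qed.

(** * Harmonic numbers compared with logarithms *)

Lemma ln_succ_bounds (x : R) : 0 < x -> / (x + 1) <= ln (x + 1) - ln x <= / x.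
Proof.
  intros hx.
  assert (hln : forall t, 0 < t -> ln t <= t - 1).
  { intros t ht. pose proof (exp_ineq1_le (ln t)). rewrite exp_ln in H; lra. }
  split.
  - pose proof (hln (x / (x + 1))) as h.
    rewrite ln_div in h by lra.
    assert (x / (x + 1) - 1 = - / (x + 1)) by (field; lra).
    assert (0 < x / (x + 1)) by (apply Rdiv_lt_0_compat; lra). lra.
  - pose proof (hln ((x + 1) / x)) as h.
    rewrite ln_div in h by lra.
    assert ((x + 1) / x - 1 = / x) by (field; lra).
    assert (0 < (x + 1) / x) by (apply Rdiv_lt_0_compat; lra). lra.
Qed.

Lemma harmonic_diff_bounds (n k : nat) : (1 <= n)%nat ->
  ln (INR (n + k) + 1) - ln (INR n + 1)
    <= harmonic (n + k) - harmonic n <= ln (INR (n + k)) - ln (INR n).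
Proof.
  intros hn. apply (lt_INR 0) in hn. simpl in hn.
  induction k as [|k IH]; [rewrite Nat.add_0_r; lra|].
  rewrite Nat.add_succ_r, harmonic_S, S_INR. pose proof (pos_INR k).
  assert (h0 : 0 < INR (n + k)) by (rewrite plus_INR; lra).
  pose proof (ln_succ_bounds _ h0).
  pose proof (ln_succ_bounds (INR (n + k) + 1) ltac:(lra)). lra.
Qed.

Lemma harmonic_half_lim :
  is_lim_seq (fun m => harmonic (2 * m) - harmonic m) (ln 2).
Proof.
  apply is_lim_seq_incr_1.
  apply is_lim_seq_le_le with
    (u := fun m => ln 2 - / (2 * INR (S m) + 1)) (w := fun _ => ln 2).
  - intros m. pose proof (harmonic_diff_bounds (S m) (S m) ltac:(lia)) as h.
    replace (S m + S m)%nat with (2 * S m)%nat in h by lia.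
    rewrite mult_INR in h. simpl (INR 2) in h.
    assert (hp : 0 < INR (S m)) by (apply lt_0_INR; lia).
    set (x := INR (S m)) in *. replace (1 + 1) with 2 in h by ring.
    rewrite (ln_mult 2 x) in h by lra.
    (* The lower bound [ln (2x + 1) - ln (x + 1)] differs from [ln 2] by
       [ln (2x + 2) - ln (2x + 1)]. *)
    pose proof (ln_succ_bounds (2 * x + 1) ltac:(lra)) as h2.
    replace (2 * x + 1 + 1) with (2 * (x + 1)) in h2 by ring.
    rewrite ln_mult in h2 by lra. lra.
  - replace (Finite (ln 2)) with (Finite (ln 2 - 0)) by (f_equal; ring).
    apply is_lim_seq_minus'; [apply is_lim_seq_const|].
    apply (is_lim_seq_incr_1 (fun m => / (2 * INR m + 1))), is_lim_seq_inv_INR.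
  - apply is_lim_seq_const.
Qed.

(** With [r = sqrt (2m + 1)], [wallis m <= 1 / r] and [harmonic (2m) <= 1 + 2 ln r], so
    [ln r / r -> 0] concludes. *)
Lemma wallis_harmonic_lim :
  is_lim_seq (fun m => wallis m * (1 + harmonic (2 * m))) 0.
Proof.
  apply is_lim_seq_incr_1.
  set (r := fun m => sqrt (2 * INR m + 1)).
  assert (hr : is_lim_seq r p_infty).
  { apply is_lim_seq_ext with (fun m => sqrt (INR (2 * m + 1))).
    { intros m. unfold r. rewrite plus_INR, mult_INR. reflexivity. }
    apply (filterlim_comp _ _ _ _ sqrt _ (Rbar_locally p_infty));
      [|apply filterlim_sqrt_p].
    apply (is_lim_seq_subseq INR p_infty (fun m => (2 * m + 1)%nat)).
    - apply eventually_subseq. intros n. lia.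
    - apply is_lim_seq_INR. }
  apply is_lim_seq_le_le with (u := fun _ => 0)
    (w := fun m => 2 * / r (S m) + 2 * (ln (r (S m)) / r (S m))).
  - intros m. pose proof (wallis_pos (S m)) as hw.
    pose proof (harmonic_nonneg (2 * S m)) as hh.
    split; [apply Rmult_le_pos; lra|].
    assert (hp : 0 < INR (S m)) by (apply lt_0_INR; lia).
    assert (hr0 : 0 < r (S m)) by (apply sqrt_lt_R0; lra).
    assert (hrr : r (S m) * r (S m) = 2 * INR (S m) + 1) by (apply sqrt_sqrt; lra).
    assert (hwr : wallis (S m) <= / r (S m)).
    { pose proof (wallis_sqr_le (S m)) as h. rewrite <- hrr in h.
      rewrite <- (Rmult_1_l (/ _)). apply -> Rle_div_r; [|exact hr0].
      assert (0 < wallis (S m) * r (S m)) by now apply Rmult_lt_0_compat.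
      nra. }
    assert (hh2 : harmonic (2 * S m) <= 1 + 2 * ln (r (S m))).
    { replace (2 * ln (r (S m))) with (ln (2 * INR (S m) + 1)) by
        (rewrite <- hrr, ln_mult by assumption; ring).
      pose proof (harmonic_diff_bounds 1 (2 * m + 1) ltac:(lia)) as [_ h].
      replace (1 + (2 * m + 1))%nat with (2 * S m)%nat in h by lia.
      rewrite mult_INR, (harmonic_S 0), harmonic_0 in h. simpl (INR 1) in h.
      rewrite ln_1, Rinv_1 in h. simpl (INR 2) in h.
      assert (ln ((1 + 1) * INR (S m)) <= ln (2 * INR (S m) + 1))
        by (apply ln_le; lra). lra. }
    apply Rle_trans with (/ r (S m) * (2 + 2 * ln (r (S m)))).
    + apply Rmult_le_compat; lra.
    + right. field. lra.
  - apply is_lim_seq_const.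
  - apply (is_lim_seq_incr_1 (fun m => 2 * / r m + 2 * (ln (r m) / r m))).
    replace (Finite 0) with (Finite (2 * 0 + 2 * 0)) by (f_equal; ring).
    apply is_lim_seq_plus'.
    + apply is_lim_seq_scal_l with (lu := 0).
      apply (is_lim_seq_inv _ p_infty); [exact hr|discriminate].
    + apply is_lim_seq_scal_l with (lu := 0).
      apply (is_lim_comp_seq (fun y => ln y / y) r p_infty);
        [apply is_lim_div_ln_p| |exact hr].
      exists O. intros n _. discriminate.
Qed.

(** * Values at [-1/2] and vanishing of the certificate terms *)

Lemma is_lim_seq_abs_le_0 (u v : nat -> R) :
  (forall n, Rabs (u n) <= v n) -> is_lim_seq v 0 -> is_lim_seq u 0.
Proof.
  intros h hv. apply is_lim_seq_abs_0.
  apply is_lim_seq_le_le with (u := fun _ => 0) (w := v);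
    [|apply is_lim_seq_const|exact hv].
  intros n. split; [apply Rabs_pos|apply h].
Qed.

(** Writing [-1/2] as [INR 0 - 1 / 2] makes it the case [m = 0] of [INR m - 1 / 2]. *)
Lemma quot_neg_half (k : nat) : quot (INR 0 - 1 / 2) k = (-1) ^ k * wallis k.
Proof.
  induction k as [|k IH]; [simpl; ring|]. pose proof (pos_INR k).
  rewrite (quot_S (INR 0 - 1 / 2) k).
  rewrite IH, wallis_S. simpl. field. lra.
Qed.

(** The harmonic numbers enter here: the factor of index [j] has logarithmic derivative [- 1/(j +
    1/2) - 1/(j + 1) = -2 (1/(2j + 1) + 1/(2j + 2))]. *)
Lemma dquot_neg_half (k : nat) :
  dquot (INR 0 - 1 / 2) k = - 2 * harmonic (2 * k) * quot (INR 0 - 1 / 2) k.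
Proof.
  induction k as [|k IH]; [simpl; rewrite harmonic_0; ring|].
  pose proof (pos_INR k).
  rewrite (quot_S (INR 0 - 1 / 2) k).
  rewrite (dquot_S (INR 0 - 1 / 2) k).
  rewrite IH. replace (2 * S k)%nat with (S (S (2 * k))) by lia.
  rewrite !harmonic_S, !S_INR, mult_INR. simpl. field. lra.
Qed.

(** The case [m = 0] is explicit. The shift lemmas carry it upward: their rational factor lies in
    [[0, 1]] and its logarithmic derivative is bounded uniformly in the index. *)
Lemma quot_lim (m : nat) :
  is_lim_seq (quot (INR m - 1 / 2)) 0 /\ is_lim_seq (dquot (INR m - 1 / 2)) 0.
Proof.
  induction m as [|m [h1 h2]].
  - pose proof wallis_harmonic_lim as hl.
    assert (hq : forall n, Rabs (quot (INR 0 - 1 / 2) n) = wallis n).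
    { intros n. rewrite quot_neg_half, Rabs_mult, pow_1_abs, Rmult_1_l.
      apply Rabs_pos_eq. left. apply wallis_pos. }
    split.
    + apply is_lim_seq_abs_le_0 with (2 := hl). intros n. rewrite hq.
      pose proof (wallis_pos n). pose proof (harmonic_nonneg (2 * n)). nra.
    + apply is_lim_seq_abs_le_0 with
        (fun n => 2 * (wallis n * (1 + harmonic (2 * n)))).
      * intros n. pose proof (wallis_pos n). pose proof (harmonic_nonneg (2 * n)).
        rewrite dquot_neg_half, Rabs_mult, hq, Rabs_left1 by nra. nra.
      * replace (Finite 0) with (Rbar_mult 2 0) by (simpl; f_equal; ring).
        now apply is_lim_seq_scal_l.
  - pose proof (pos_INR m) as hm.
    rewrite S_INR. replace (INR m + 1 - 1 / 2) with (INR m - 1 / 2 + 1) by ring.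
    set (y := INR m - 1 / 2) in *.
    assert (hy : - (1 / 2) <= y) by (unfold y; lra).
    assert (hs : forall n, 0 <= (y + 1) * (y + 3 / 2)
                   / ((y + 3 / 2 + INR n) * (y + 5 / 2 + INR n)) <= 1).
    { intros n. pose proof (pos_INR n).
      assert (0 < (y + 3 / 2 + INR n) * (y + 5 / 2 + INR n))
        by (apply Rmult_lt_0_compat; lra).
      split; [apply Rdiv_le_0_compat|apply -> Rdiv_le_1]; try assumption.
      - apply Rmult_le_pos; lra.
      - apply Rmult_le_compat; lra. }
    apply is_lim_seq_abs_0 in h1, h2. split; apply is_lim_seq_incr_1.
    + apply is_lim_seq_abs_le_0 with (2 := h1). intros n.
      rewrite quot_shift, Rabs_mult by exact hy. specialize (hs n).
      rewrite (Rabs_pos_eq (_ / _)) by apply hs.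
      pose proof (Rabs_pos (quot y n)). nra.
    + apply is_lim_seq_abs_le_0 with
        (fun n => Rabs (dquot y n) + 5 * Rabs (quot y n)).
      * intros n. rewrite dquot_shift, Rabs_mult by exact hy. specialize (hs n).
        rewrite (Rabs_pos_eq (_ / _)) by apply hs.
        pose proof (pos_INR n).
        match goal with |- Rabs (?d + ?a * ?c) * ?s <= _ =>
          assert (hc : Rabs c <= 5); [|
          assert (ht : Rabs (d + a * c) <= Rabs d + 5 * Rabs a)] end.
        { assert (0 < / (y + 3 / 2 + INR n) <= / (y + 3 / 2)) by
            (split; [apply Rinv_0_lt_compat|apply Rinv_le_contravar]; lra).
          assert (0 < / (y + 5 / 2 + INR n) <= / (y + 3 / 2)) by
            (split; [apply Rinv_0_lt_compat|apply Rinv_le_contravar]; lra).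
          assert (0 < / (y + 1)) by (apply Rinv_0_lt_compat; lra).
          assert (/ (y + 1) <= / (1 / 2)) by (apply Rinv_le_contravar; lra).
          assert (/ (y + 3 / 2) <= / 1) by (apply Rinv_le_contravar; lra).
          apply Rabs_le. lra. }
        { apply Rle_trans with (1 := Rabs_triang _ _). rewrite Rabs_mult.
          pose proof (Rabs_pos (quot y n)). nra. }
        pose proof (Rabs_pos (quot y n)). pose proof (Rabs_pos (dquot y n)). nra.
      * replace (Finite 0) with (Finite (0 + 5 * 0)) by (f_equal; ring).
        apply is_lim_seq_plus'; [exact h2|].
        now apply is_lim_seq_scal_l with (lu := 0).
Qed.

Lemma cert_quot_lim (m : nat) :
  is_lim_seq (fun n => cert (INR m - 1 / 2) n * quot (INR m - 1 / 2) n) 0.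
Proof.
  destruct (quot_lim m) as [h _]. apply is_lim_seq_abs_0 in h.
  apply is_lim_seq_abs_le_0 with (2 := h). intros n. pose proof (pos_INR m).
  rewrite Rabs_mult. pose proof (cert_bound (INR m - 1 / 2) n ltac:(lra)).
  pose proof (Rabs_pos (quot (INR m - 1 / 2) n)). nra.
Qed.

Lemma cert_dquot_lim (m : nat) :
  is_lim_seq (fun n => cert (INR m - 1 / 2) n *
    (dquot (INR m - 1 / 2) n
     - quot (INR m - 1 / 2) n / (INR m - 1 / 2 + 3 / 2 + INR n))) 0.
Proof.
  destruct (quot_lim m) as [h1 h2]. apply is_lim_seq_abs_0 in h1, h2.
  apply is_lim_seq_abs_le_0 with
    (fun n => Rabs (dquot (INR m - 1 / 2) n) + Rabs (quot (INR m - 1 / 2) n)).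
  - intros n. pose proof (pos_INR m). pose proof (pos_INR n).
    set (a := quot (INR m - 1 / 2) n). set (d := dquot (INR m - 1 / 2) n).
    rewrite Rabs_mult.
    assert (ht : Rabs (d - a / (INR m - 1 / 2 + 3 / 2 + INR n)) <= Rabs d + Rabs a).
    { apply Rle_trans with (1 := Rabs_triang _ _). apply Rplus_le_compat_l.
      rewrite Rabs_Ropp. unfold Rdiv. rewrite Rabs_mult.
      rewrite <- (Rmult_1_r (Rabs a)) at 2.
      apply Rmult_le_compat_l; [apply Rabs_pos|].
      rewrite Rabs_pos_eq by (left; apply Rinv_0_lt_compat; lra).
      apply Rle_trans with (/ 1); [apply Rinv_le_contravar; lra|lra]. }
    pose proof (cert_bound (INR m - 1 / 2) n ltac:(lra)).
    pose proof (Rabs_pos (d - a / (INR m - 1 / 2 + 3 / 2 + INR n))). nra.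
  - replace (Finite 0) with (Finite (0 + 0)) by (f_equal; ring).
    now apply is_lim_seq_plus'.
Qed.

(** * Transport from [-1/2] to [m - 1/2], and exchange of limits *)

Lemma qsum_transport (m : nat) :
  is_lim_seq (fun N => qsum (INR 0 - 1 / 2) N - wallis m * qsum (INR m - 1 / 2) N) 0.
Proof.
  induction m as [|m IH].
  - apply is_lim_seq_ext with (fun _ => 0); [intros N; simpl; ring|].
    apply is_lim_seq_const.
  - pose proof (pos_INR m) as hm.
    apply is_lim_seq_ext with (fun N =>
      (qsum (INR 0 - 1 / 2) N - wallis m * qsum (INR m - 1 / 2) N)
      - wallis m * (cert (INR m - 1 / 2) N * quot (INR m - 1 / 2) N)).
    + intros N. rewrite wallis_S, S_INR.
      replace (INR m + 1 - 1 / 2) with (INR m - 1 / 2 + 1) by ring.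
      (* [rho (m - 1/2) = (m + 1) / (m + 1/2)] cancels the new factor of [wallis (S m)]. *)
      rewrite qsum_shift by lra. unfold rho. field. lra.
    + replace (Finite 0) with (Finite (0 - wallis m * 0)) by (f_equal; ring).
      apply is_lim_seq_minus'; [exact IH|].
      apply is_lim_seq_scal_l with (lu := 0). apply cert_quot_lim.
Qed.

(* The logarithmic derivatives of [rho] at [j - 1/2], [j < m], add up to
   [- 2 * (harmonic (2 * m) - harmonic m)]. *)
Lemma dqsum_transport (m : nat) :
  is_lim_seq (fun N =>
    dqsum (INR 0 - 1 / 2) N - wallis m * dqsum (INR m - 1 / 2) N
    - 2 * (harmonic (2 * m) - harmonic m) * qsum (INR 0 - 1 / 2) N) 0.
Proof.
  induction m as [|m IH].
  - apply is_lim_seq_ext with (fun _ => 0); [|apply is_lim_seq_const].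
    intros N. simpl (2 * 0)%nat. simpl (wallis 0). ring.
  - pose proof (pos_INR m) as hm.
    (* [delta] is [- drho / rho] at [m - 1/2], and also the increment of
       [2 * (harmonic (2 * m) - harmonic m)]. *)
    set (delta := / (INR m + 1 / 2) - / (INR m + 1)).
    apply is_lim_seq_ext with (fun N =>
      (dqsum (INR 0 - 1 / 2) N - wallis m * dqsum (INR m - 1 / 2) N
       - 2 * (harmonic (2 * m) - harmonic m) * qsum (INR 0 - 1 / 2) N)
      - wallis m * (cert (INR m - 1 / 2) N *
          (dquot (INR m - 1 / 2) N
           - quot (INR m - 1 / 2) N / (INR m - 1 / 2 + 3 / 2 + INR N)))
      - delta * (qsum (INR 0 - 1 / 2) N - wallis m * qsum (INR m - 1 / 2) N)
      + delta * wallis m * (cert (INR m - 1 / 2) N * quot (INR m - 1 / 2) N)).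
    + intros N. pose proof (pos_INR N).
      replace (2 * S m)%nat with (S (S (2 * m))) by lia.
      rewrite wallis_S, !harmonic_S, !S_INR, mult_INR.
      replace (INR m + 1 - 1 / 2) with (INR m - 1 / 2 + 1) by ring.
      rewrite dqsum_shift by lra. unfold rho, drho, delta.
      generalize (cert (INR m - 1 / 2) N). intros c. simpl. field. lra.
    + replace (Finite 0) with
        (Finite (0 - wallis m * 0 - delta * 0 + delta * wallis m * 0))
        by (f_equal; ring).
      apply is_lim_seq_plus'; [apply is_lim_seq_minus'; [apply is_lim_seq_minus'|]|].
      * exact IH.
      * apply is_lim_seq_scal_l with (lu := 0). apply cert_dquot_lim.
      * apply is_lim_seq_scal_l with (lu := 0). apply qsum_transport.
      * apply is_lim_seq_scal_l with (lu := 0). apply cert_quot_lim.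
Qed.

(** First [m] is fixed so that [eps m] is small, then [N] is taken large. The index [m + S n] ranges
    over all [N > m], so the second hypothesis is uniform in [N]. *)
Lemma is_lim_seq_by_approx (u : nat -> R) (v : nat -> nat -> R) (eps : nat -> R)
    (l : R) :
  (forall m, is_lim_seq (fun N => u N - v m N) 0) ->
  (forall m n, (1 <= m)%nat -> Rabs (v m (m + S n)%nat - l) <= eps m) ->
  is_lim_seq eps 0 -> is_lim_seq u l.
Proof.
  intros huv hv heps. apply is_lim_seq_spec. intros e.
  assert (he : 0 < e / 2) by (pose proof (cond_pos e); lra).
  apply is_lim_seq_spec in heps. destruct (heps (mkposreal _ he)) as [m0 hm0].
  set (m := S m0). specialize (hm0 m ltac:(unfold m; lia)). simpl in hm0.
  specialize (huv m). apply is_lim_seq_spec in huv.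
  destruct (huv (mkposreal _ he)) as [N0 hN0]. simpl in hN0.
  exists (N0 + S m)%nat. intros N hN. specialize (hN0 N ltac:(lia)).
  specialize (hv m (N - S m)%nat ltac:(unfold m; lia)).
  replace (m + S (N - S m))%nat with N in hv by lia.
  rewrite Rminus_0_r in hm0, hN0.
  replace (u N - l) with ((u N - v m N) + (v m N - l)) by ring.
  apply Rle_lt_trans with (1 := Rabs_triang _ _).
  pose proof (Rle_abs (eps m)). lra.
Qed.

(** * The limits of the sum and of its derivative at [-1/2] *)

Lemma wallis_lim : is_lim_seq wallis 0.
Proof.
  apply is_lim_seq_abs_le_0 with (2 := wallis_harmonic_lim). intros m.
  pose proof (wallis_pos m). pose proof (harmonic_nonneg (2 * m)).
  rewrite Rabs_pos_eq; nra.
Qed.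

Lemma qsum_lim : is_lim_seq (qsum (INR 0 - 1 / 2)) (2 / PI).
Proof.
  apply is_lim_seq_by_approx with
    (v := fun m N => wallis m * qsum (INR m - 1 / 2) N)
    (eps := fun m => Rabs ((2 * INR m + 1) * wallis m ^ 2 - 2 / PI)
                     + 25 * wallis m).
  - apply qsum_transport.
  - intros m n hm. pose proof (qsum_bounds m n hm) as h.
    pose proof (wallis_pos m) as hw.
    (* The lower bound of [qsum_bounds] misses the main term by an extra [wallis m ^ 2]; absorbing
       it turns 24 into 25. *)
    assert (hw2 : wallis m ^ 2 <= wallis m).
    { pose proof (wallis_sqr_le m). pose proof (pos_INR m).
      pose proof (pow2_ge_0 (wallis m)). assert (wallis m ^ 2 <= 1) by nra. nra. }
    set (x := (2 * INR m + 1) * wallis m ^ 2) in *.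
    replace (2 * INR m * wallis m ^ 2) with (x - wallis m ^ 2) in h
      by (unfold x; ring).
    pose proof (Rle_abs (x - 2 / PI)). pose proof (Rle_abs (- (x - 2 / PI))) as h2.
    rewrite Rabs_Ropp in h2.
    apply Rabs_le. lra.
  - replace (Finite 0) with (Finite (0 + 25 * 0)) by (f_equal; ring).
    apply is_lim_seq_plus'.
    + apply (is_lim_seq_abs_0 (fun m => (2 * INR m + 1) * wallis m ^ 2 - 2 / PI)).
      replace (Finite 0) with (Finite (2 / PI - 2 / PI)) by (f_equal; ring).
      apply is_lim_seq_minus'; [apply wallis_sqr_lim|apply is_lim_seq_const].
    + apply is_lim_seq_scal_l with (lu := 0). apply wallis_lim.
Qed.

Lemma odd_harmonic_le (m : nat) : odd_harmonic m <= 2 * harmonic (2 * m).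
Proof. unfold odd_harmonic. pose proof (harmonic_nonneg m). lra. Qed.

(** It suffices that [dqsum - 2 ln 2 * qsum] tends to 0. Replacing [harmonic (2 * m) - harmonic m]
    by [ln 2] costs a multiple of [qsum], controlled uniformly in [N] because the convergent
    sequence [qsum] is bounded by some [M]. *)
Lemma dqsum_lim : is_lim_seq (dqsum (INR 0 - 1 / 2)) (2 * ln 2 * (2 / PI)).
Proof.
  destruct (filterlim_bounded (K := R_AbsRing) (V := R_NormedModule)
    (qsum (INR 0 - 1 / 2)) (ex_intro _ (2 / PI) qsum_lim)) as [M hM].
  assert (hM' : forall n, Rabs (qsum (INR 0 - 1 / 2) n) <= M) by exact hM.
  apply is_lim_seq_ext with (fun N =>
    (dqsum (INR 0 - 1 / 2) N - 2 * ln 2 * qsum (INR 0 - 1 / 2) N)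
    + 2 * ln 2 * qsum (INR 0 - 1 / 2) N); [intros N; ring|].
  replace (Finite (2 * ln 2 * (2 / PI))) with (Finite (0 + 2 * ln 2 * (2 / PI)))
    by (f_equal; ring).
  apply is_lim_seq_plus';
    [|apply is_lim_seq_scal_l with (lu := 2 / PI); apply qsum_lim].
  apply is_lim_seq_by_approx with
    (v := fun m N => wallis m * dqsum (INR m - 1 / 2) N
      + 2 * (harmonic (2 * m) - harmonic m - ln 2) * qsum (INR 0 - 1 / 2) N)
    (eps := fun m => 128 * (wallis m * (1 + harmonic (2 * m)))
      + 2 * M * Rabs (harmonic (2 * m) - harmonic m - ln 2)).
  - intros m. apply is_lim_seq_ext with (2 := dqsum_transport m). intros N. ring.
  - intros m n hm. rewrite Rminus_0_r. apply Rle_trans with (1 := Rabs_triang _ _).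
    pose proof (dqsum_bound m n hm) as h. pose proof (wallis_pos m) as hw.
    pose proof (odd_harmonic_le m). apply Rplus_le_compat.
    + rewrite Rabs_mult, (Rabs_pos_eq (wallis m)) by lra. nra.
    + rewrite !Rabs_mult, (Rabs_pos_eq 2) by lra.
      specialize (hM' (m + S n)%nat).
      pose proof (Rabs_pos (harmonic (2 * m) - harmonic m - ln 2)). nra.
  - replace (Finite 0) with (Finite (128 * 0 + 2 * M * 0)) by (f_equal; ring).
    apply is_lim_seq_plus'.
    + apply is_lim_seq_scal_l with (lu := 0). apply wallis_harmonic_lim.
    + apply is_lim_seq_scal_l with (lu := 0).
      apply (is_lim_seq_abs_0 (fun m => harmonic (2 * m) - harmonic m - ln 2)).
      replace (Finite 0) with (Finite (ln 2 - ln 2)) by (f_equal; ring).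
      apply is_lim_seq_minus'; [apply harmonic_half_lim|apply is_lim_seq_const].
Qed.

(** * Back to central binomial coefficients and the series *)

Lemma central_binomial (i : nat) : Binomial.C (2 * i) i = 4 ^ i * wallis i.
Proof.
  assert (hC : forall j, Binomial.C (2 * j) j = INR (Factorial.fact (2 * j)) / INR (Factorial.fact j) ^ 2).
  { intros j. unfold Binomial.C. replace (2 * j - j)%nat with j by lia.
    field. apply INR_fact_neq_0. }
  rewrite hC. induction i as [|i IH]; [simpl; field|].
  pose proof (pos_INR i). pose proof (INR_fact_neq_0 i).
  replace (2 * S i)%nat with (S (S (2 * i))) by lia.
  replace (4 ^ S i * wallis (S i))
    with (4 * ((INR i + 1 / 2) / (INR i + 1)) * (4 ^ i * wallis i))
    by (rewrite wallis_S, <- tech_pow_Rmult; ring).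
  rewrite <- IH, !fact_simpl, !mult_INR, !S_INR, mult_INR.
  simpl (INR 2). field. lra.
Qed.

Theorem theorem5 :
  is_series
    (fun i : nat =>
       (- (1 / 64)) ^ i * (Binomial.C (2 * i) i) ^ 3
       * (4 * INR i + 1) * harmonic (2 * i))
    (- (2 * ln 2 / PI)).
Proof.
  change (is_lim_seq (sum_n (fun i : nat =>
    (- (1 / 64)) ^ i * (Binomial.C (2 * i) i) ^ 3
    * (4 * INR i + 1) * harmonic (2 * i))) (- (2 * ln 2 / PI))).
  apply is_lim_seq_ext with (fun N => - (1 / 2) * dqsum (INR 0 - 1 / 2) N).
  - intros N. unfold dqsum.
    rewrite <- (sum_n_mult_l (K := R_Ring) (- (1 / 2))). apply sum_n_ext. intros i.
    unfold mult; simpl (Ring.mult _ _).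
    rewrite dquot_neg_half, quot_neg_half, central_binomial.
    (* The sign supplies [(-1/64)^i] together with [(4^i)^3], which completes [wallis i ^ 3] to the
       cube of the binomial. *)
    replace (-1) with (- (1 / 64) * 4 ^ 3) by field.
    rewrite (Rpow_mult_distr (- (1 / 64))), <- !pow_mult, (Nat.mul_comm 3), pow_mult.
    unfold weight. simpl. field.
  - replace (Finite (- (2 * ln 2 / PI)))
      with (Finite (- (1 / 2) * (2 * ln 2 * (2 / PI))))
      by (f_equal; field; apply PI_neq0).
    apply is_lim_seq_scal_l with (lu := 2 * ln 2 * (2 / PI)). apply dqsum_lim.
Qed.
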